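(* Let $0<s<1$, $\beta\in[0,1]$, $\alpha>0$, let $n$ be a positive even integer, let $g\in L^2(\mathbb{T}^d;\mathbb{C})$ and $g_n\in\mathcal{S}_n$. If $\beta>0$, assume that $g$ and $g_n$ have vanishing mean. Let $u$ (in $H^s(\mathbb{T}^d;\mathbb{C})$ if $\beta=0$, in $\mathring{H}^s(\mathbb{T}^d;\mathbb{C})$ if $\beta>0$) be the unique solution of $$(-\Delta)^su+\alpha(-\Delta)^{-\beta}u=\alpha(-\Delta)^{-\beta}g\quad\text{in }\mathbb{T}^d,$$ and let $u_n\in\mathcal{S}_n$ (with vanishing mean if $\beta>0$) be the unique solution of $$(-\Delta)^su_n+\alpha(-\Delta)^{-\beta}u_n=\alpha(-\Delta)^{-\beta}g_n .$$ Then $$|u-u_n|_s^2+\frac\alpha2|u-u_n|_{-\beta}^2\le\frac\alpha2|g-g_n|_{-\beta}^2 .$$ In particular: (i) if $g\in H^\mu(\mathbb{T}^d;\mathbb{C})$, where $\mu\ge-\beta$, and $g_n=P_ng$, then $$|u-u_n|_s+(\alpha/2)^{1/2}|u-u_n|_{-\beta}\le\alpha^{1/2}\Big(\frac n2\Big)^{-(\mu+\beta)}|g|_\mu;$$ (ii) if $g\in H^\nu(\mathbb{T}^d;\mathbb{C})$ with $\nu>d/2$ and $g_n=I_ng$, then $$|u-u_n|_s+(\alpha/2)^{1/2}|u-u_n|_{-\beta}\le\alpha^{1/2}c_{d,0,\nu}\Big(\frac n2\Big)^{-\nu}|g|_\nu .$$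
   Context: $\mathbb{T}^d$, $d\ge1$, is the $2\pi$-periodic torus, and $(v,w)=\int_{\mathbb{T}^d}v\overline{w}\,dx$ with norm $\|\cdot\|$. Put $\varphi^k(x)=e^{\mathrm{i}k\cdot x}$ and $\hat v_k=(v,\varphi^k)$ for $k\in\mathbb{Z}^d$, so that $v=(2\pi)^{-d}\sum_{k\in\mathbb{Z}^d}\hat v_k\varphi^k$. ''Vanishing mean'' means $\hat v_0=0$. For even $n$, $\mathbb{Z}_n^d=\{k\in\mathbb{Z}^d:-n/2\le k_i\le n/2-1\}$, $\mathbb{N}_n^d=\{j\in\mathbb{Z}^d:0\le j_i\le n-1\}$, grid points are $x_j=\frac{2\pi}{n}j$ for $j\in\mathbb{N}_n^d$, and $\mathcal{S}_n=\{\sum_{k\in\mathbb{Z}_n^d}c_k\varphi^k:c_k\in\mathbb{C}\}$. $P_n:L^2(\mathbb{T}^d;\mathbb{C})\to\mathcal{S}_n$ is the $L^2$-orthogonal projection. For continuous $v$, $I_nv\in\mathcal{S}_n$ is the trigonometric interpolant, i.e. the unique element of $\mathcal{S}_n$ with $I_nv(x_j)=v(x_j)$ for all $j\in\mathbb{N}_n^d$. For $\mu\ge0$, $H^\mu(\mathbb{T}^d;\mathbb{C})$ consists of all $v\in L^2(\mathbb{T}^d;\mathbb{C})$ with $|v|_\mu^2=\sum_{k\in\mathbb{Z}^d}|k|^{2\mu}|\hat v_k|^2<\infty$ (with $|0|^0=1$, so $|\cdot|_0$ is a constant multiple of the $L^2$ norm). For $\mu>0$, $H^{-\mu}$ is the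 dual of $H^\mu$, with $|\psi|_{-\mu}^2=\sum_{k\ne0}|k|^{-2\mu}|\hat\psi_k|^2$. In particular this formula with Fourier coefficients $\hat\psi_k$ applies to $\psi\in L^2$. For $r\in\mathbb{R}$, $\mathring{H}^r=\{v\in H^r:\hat v_0=0\}$. The fractional Laplacian is $(-\Delta)^sv=(2\pi)^{-d}\sum_{k\in\mathbb{Z}^d\setminus\{0\}}|k|^{2s}\hat v_k\varphi^k$ for $s>0$. For $\beta>0$, $(-\Delta)^{-\beta}$ is its inverse on functions with vanishing mean, $(-\Delta)^{-\beta}v=(2\pi)^{-d}\sum_{k\ne0}|k|^{-2\beta}\hat v_k\varphi^k$. For $\beta=0$, $(-\Delta)^{-\beta}$ is the identity. Equations are understood as equalities of Fourier coefficients. For $\nu>d/2$ functions in $H^\nu(\mathbb{T}^d;\mathbb{C})$ are continuous, and $c_{d,0,\nu}>0$ denotes the constant, independent of $v$ and $n$, of the known trigonometric interpolation estimate $|v-I_nv|_0\le c_{d,0,\nu}(n/2)^{-\nu}|v|_\nu$ for all $v\in H^\nu(\mathbb{T}^d;\mathbb{C})$. *)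

(* Defs.v *)
From HB Require Import structures.
From mathcomp Require Import all_boot all_order all_algebra.
From mathcomp Require Import complex.
From mathcomp Require Import all_classical all_reals all_analysis.

Set Implicit Arguments.
Unset Strict Implicit.
Unset Printing Implicit Defensive.

Import Order.TTheory GRing.Theory Num.Theory.
Import numFieldNormedType.Exports.

Local Open Scope classical_set_scope.
Local Open Scope ring_scope.

(* The torus T^d is R^d modulo (2 pi Z)^d.  Functions on it are 2 pi-periodic
   functions on R^d, and integration is over the fundamental cell [0, 2 pi[^d.
   Points of R^d are d-tuples, for which the library provides the product
   sigma-algebra. *)

Section TorusMeasure.
Context {R : realType}.

Let cell : set (measurableTypeR R) := [set` `[0 : R, 2 * pi[].

Let measurable_cell : measurable cell.
Proof. exact: measurable_itv. Qed.

Let cell_lty : (lebesgue_measure cell < +oo)%E.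
Proof.
rewrite /cell lebesgue_measure_itv/= lte_fin mulr_gt0 ?pi_gt0//.
by rewrite -EFinB ltry.
Qed.

Definition circle_measure : {finite_measure set (measurableTypeR R) -> \bar R} :=
  mfrestr measurable_cell cell_lty.

Definition cons_pt d (xy : measurableTypeR R * d.-tuple (measurableTypeR R)) :
    d.+1.-tuple (measurableTypeR R) := [the d.+1.-tuple _ of xy.1 :: xy.2].

Lemma measurable_cons_pt d : measurable_fun [set: _] (@cons_pt d).
Proof. by apply: measurable_cons. Qed.

Section Step.
Variables (d : nat)
  (mu : {finite_measure set (d.-tuple (measurableTypeR R)) -> \bar R}).

Definition torus_step : set (d.+1.-tuple (measurableTypeR R)) -> \bar R :=
  pushforward (circle_measure \x mu)%E (@cons_pt d).

Let mpre A : measurable A -> measurable (@cons_pt d @^-1` A).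
Proof. by move=> mA; rewrite -[X in measurable X]setTI; apply: measurable_cons_pt. Qed.

Let torus_step0 : torus_step set0 = 0%E.
Proof. by rewrite /torus_step /pushforward preimage_set0 measure0. Qed.

Let torus_step_ge0 A : (0 <= torus_step A)%E.
Proof. by rewrite /torus_step /pushforward measure_ge0. Qed.

Let torus_step_sigma_additive : semi_sigma_additive torus_step.
Proof.
move=> F mF tF mUF; rewrite /torus_step /pushforward preimage_bigcup.
apply: measure_semi_sigma_additive.
- by move=> n; exact: mpre.
- apply/trivIsetP => /= i j _ _ ij; rewrite -preimage_setI.
  by move/trivIsetP : tF => /(_ _ _ _ _ ij) ->//; rewrite preimage_set0.
- by rewrite -preimage_bigcup; exact: mpre.
Qed.

HB.instance Definition _ := isMeasure.Build _ _ _ torus_step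
  torus_step0 torus_step_ge0 torus_step_sigma_additive.

Let torus_step_fin : fin_num_fun torus_step.
Proof.
move=> A mA; rewrite ge0_fin_numE ?measure_ge0//.
rewrite /torus_step /pushforward.
apply: (@le_lt_trans _ _ ((circle_measure \x mu)%E setT)).
  by apply: le_measure; rewrite ?inE//; exact: mpre.
rewrite -setXTT product_measure1E//.
by rewrite ltey_eq fin_numM// fin_num_measure.
Qed.

HB.instance Definition _ := Measure_isFinite.Build _ _ _ torus_step
  torus_step_fin.

End Step.

(* d-dimensional Lebesgue measure restricted to [0, 2 pi[^d, as the iterated
   product of its one-dimensional version. *)
Fixpoint torus_measure d :
    {finite_measure set (d.-tuple (measurableTypeR R)) -> \bar R} :=
  match d with
  | 0 => @dirac _ (0.-tuple (measurableTypeR R)) [tuple] R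
  | d'.+1 => torus_step (torus_measure d')
  end.

End TorusMeasure.

Section Torus.
Context {R : realType} {d : nat}.

Local Notation pt := (d.-tuple R).
Local Notation freq := {ffun 'I_d -> int}.
Local Notation mu := (@torus_measure R d).

Implicit Types (v w p : pt -> R[i]) (k : freq) (n : nat).

Definition periodic v :=
  forall (x : pt) (i : 'I_d),
    v [tuple tnth x j + 2 * pi * (j == i)%:R | j < d] = v x.

(* Continuity as a function on R^d, which carries its topology on row vectors. *)
Definition continuous_on_torus v :=
  periodic v /\
  continuous (fun x : 'rV[R]_d => complex.Re (v [tuple x ord0 i | i < d])) /\
  continuous (fun x : 'rV[R]_d => complex.Im (v [tuple x ord0 i | i < d])).

(* Functions representing an element of L^2(T^d; C); equality in L^2 is
   equality mu-almost everywhere. *)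
Definition in_L2 v :=
  [/\ periodic v,
      measurable_fun [set: pt] (fun x => complex.Re (v x)),
      measurable_fun [set: pt] (fun x => complex.Im (v x)) &
      (\int[mu]_x ((Normc.normc (v x)) ^+ 2)%:E < +oo)%E].

Definition cintegral v : R[i] :=
  Complex (\int[mu]_x complex.Re (v x)) (\int[mu]_x complex.Im (v x)).

Definition inner v w : R[i] := cintegral (fun x => v x * conjc (w x)).

(* e^{i k.x} *)
Definition phi k : pt -> R[i] := fun x =>
  let t := \sum_(i < d) (k i)%:~R * tnth x i in Complex (cos t) (sin t).

Definition fourier v k : R[i] := inner v (phi k).

Definition vanishing_mean v := fourier v 0 = 0.

Definition freq_norm k : R := Num.sqrt (\sum_(i < d) (k i)%:~R ^+ 2).

(* |v|_r^2 for any real r, for v in L^2.  Since [powR 0 0 = 1] and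
   [powR 0 r = 0] for r <> 0, the frequency k = 0 is included with weight
   |0|^0 = 1 when r = 0, and does not contribute otherwise, in particular for
   r < 0. *)
Definition sobolev_sqnorm (r : R) v : \bar R :=
  (\esum_(k in [set: freq])
     (freq_norm k `^ (2 * r) * (Normc.normc (fourier v k)) ^+ 2)%:E)%E.

Definition sobolev_norm (r : R) v : \bar R := sqrte (sobolev_sqnorm r v).

(* For r >= 0 this is membership in H^r.  For r < 0 it is membership in H^r of
   an element of L^2. *)
Definition in_H (r : R) v := in_L2 v /\ (sobolev_sqnorm r v < +oo)%E.

(* Fourier coefficients of (-Delta)^s v and of (-Delta)^{-beta} v.  The former
   need not be a function when v is only in H^s. *)
Definition fractional_laplacian (s : R) v : freq -> R[i] := fun k =>
  if k == 0 then 0 else (freq_norm k `^ (2 * s))%:C%C * fourier v k.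

Definition inv_fractional_laplacian (beta : R) v : freq -> R[i] := fun k =>
  if beta == 0 then fourier v k
  else if k == 0 then 0
  else (freq_norm k `^ (- (2 * beta)))%:C%C * fourier v k.

Definition solves_equation (s beta alpha : R) (u g : pt -> R[i]) :=
  forall k : freq,
    fractional_laplacian s u k
      + alpha%:C%C * inv_fractional_laplacian beta u k
    = alpha%:C%C * inv_fractional_laplacian beta g k.

(* Meant for even n, so that n./2 is n / 2. *)
Definition Zn n : set freq :=
  [set k | forall i, - (n./2)%:Z <= k i <= (n./2)%:Z - 1].

Definition in_Sn n p :=
  exists c : freq -> R[i], forall x, p x = \sum_(k \in Zn n) c k * phi k x.

Definition grid_point n (j : {ffun 'I_d -> 'I_n}) : pt :=
  [tuple 2 * pi / n%:R * (j i)%:R | i < d].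

(* p = P_n v *)
Definition is_L2_projection n v p :=
  in_Sn n p /\ forall w, in_Sn n w -> inner (fun x => v x - p x) w = 0.

(* p = I_n v, for v with a continuous representative w *)
Definition is_interpolant n v p :=
  exists w, [/\ continuous_on_torus w,
                {ae mu, forall x, w x = v x},
                in_Sn n p &
                forall j : {ffun 'I_d -> 'I_n},
                  p (grid_point j) = w (grid_point j)].

End Torus.

(* c is a constant c_{d,0,nu} of the trigonometric interpolation estimate,
   independent of v and n. *)
Definition interpolation_constant (R : realType) (d : nat) (nu c : R) :=
  0 < c /\
  forall (n : nat) (v vn : d.-tuple R -> R[i]),
    (0 < n)%N -> ~~ odd n -> in_H nu v -> is_interpolant n v vn ->
    (sobolev_norm 0 (fun x => (v x - vn x)%R)
       <= (c * (n%:R / 2) `^ (- nu))%:E * sobolev_norm nu v)%E.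

(* Main.v *)
Require Import Defs.
From HB Require Import structures.
From mathcomp Require Import all_boot all_order all_algebra.
From mathcomp Require Import complex ring lra zify.
From mathcomp Require Import all_classical all_reals all_analysis.
From mathcomp Require Import measurable_realfun.

(* Frequency by frequency, the equation for u - u_n reads (a + c) E = c G with
   a = |k|^(2s) and c = alpha |k|^(-2 beta), and (a + c)^2 >= c^2 + 2 a c gives
   a |E|^2 + (c/2) |E|^2 <= (c/2) |G|^2; the stability estimate is the sum over
   k.  For P_n, orthogonality of the exponentials leaves in g - P_n g only the
   frequencies outside Z_n^d, all of which satisfy |k| >= n/2.  For I_n,
   |.|_(-beta) <= |.|_0. *)

Set Implicit Arguments.
Unset Strict Implicit.
Unset Printing Implicit Defensive.

Import Order.TTheory GRing.Theory Num.Theory.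
Import numFieldNormedType.Exports.
Local Open Scope classical_set_scope.
Local Open Scope ring_scope.

(** * Integrals of nonconstant exponentials over the torus *)

Section Orthogonality.
Context {R : realType}.
Local Notation circle := (@circle_measure R).
Local Notation torus := (@torus_measure R).
Local Notation pt d := (d.-tuple (measurableTypeR R)).

Definition dot d (k : 'I_d -> int) (x : pt d) : R :=
  \sum_(i < d) (k i)%:~R * tnth x i.

Lemma sinDpi2z (a : R) (m : int) : sin (a + m%:~R * (2 * pi)) = sin a.
Proof.
have -> : 2 * pi = (pi : R) *+ 2 by rewrite mulr_natl.
case: m => p.
  by rewrite -pmulrn mulr_natl; exact: periodicn (@sinD2pi R) _ _.
(* For negative [m], periodicity is applied at the shifted point, whose translate by [p.+1] periods
   is [a]. *)
rewrite NegzE mulrNz mulNr -pmulrn mulr_natl.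
by rewrite -[LHS](periodicn (@sinD2pi R) p.+1) subrK.
Qed.

Lemma measurable_dot d (k : 'I_d -> int) : measurable_fun setT (dot k).
Proof.
apply: measurable_sum => i; apply: measurable_funM; first exact: measurable_cst.
exact: measurable_tnth.
Qed.

Lemma measurable_cos_dot d (k : 'I_d -> int) (a : R) :
  measurable_fun setT (fun x : pt d => cos (a + dot k x)).
Proof.
apply: measurableT_comp.
  exact: continuous_measurable_fun (@continuous_cos R).
by apply: measurable_funD; [exact: measurable_cst|exact: measurable_dot].
Qed.

Lemma bounded_cos (T : Type) (f : T -> R) (D : set T) :
  [bounded cos (f x) | x in D].
Proof.
exists 1; split; first exact: num_real.
move=> M /ltW M1 x _ /=.
by rewrite (le_trans _ M1)// ler_norml cos_geN1 cos_le1.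
Qed.

Lemma integrable_cos dp (T : measurableType dp)
    (mu : {measure set T -> \bar R}) (f : T -> R) :
  (mu setT < +oo)%E -> measurable_fun setT f ->
  mu.-integrable setT (EFin \o (cos \o f)).
Proof.
move=> muT mf; apply: measurable_bounded_integrable => //.
- apply: measurableT_comp => //.
  exact: continuous_measurable_fun (@continuous_cos R).
- exact: bounded_cos.
Qed.

(** [circle_measure] is a measure on the whole line that gives no mass to the complement of the
    cell; inside the cell it agrees with Lebesgue measure. *)
Lemma integral_circle (f : measurableTypeR R -> \bar R) :
  circle.-integrable setT f ->
  (\int[circle]_x f x =
   \int[lebesgue_measure]_(x in [set` `[(0 : R), (2 * pi)%R[%R]) f x)%E.
Proof.
move=> intf; pose cell : set (measurableTypeR R) := [set` `[(0 : R), 2 * pi[].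
have mcell : measurable cell by exact: measurable_itv.
rewrite (@negligible_integral _ _ _ circle setT (~` cell))//; last 2 first.
- exact: measurableC.
- by rewrite /circle_measure /= /mfrestr /mrestr setICl measure0.
rewrite setTD setCK.
apply: eq_measure_integral => A mA Acell.
by rewrite /circle_measure /= /mfrestr /mrestr setIidl.
Qed.

(** The primitive [sin (a + m x) / m] takes the same value at both ends of a period. *)
Lemma integral_circle_cos (a : R) (m : int) : m != 0 ->
  (\int[circle]_x (cos (a + m%:~R * x))%:E = 0)%E.
Proof.
move=> m0.
have mf : measurable_fun setT (fun x : measurableTypeR R => a + m%:~R * x).
  apply: measurable_funD; first exact: measurable_cst.
  exact: measurable_funM (measurable_cst _) (@measurable_id _ _ _).
have mR0 : m%:~R != 0 :> R by rewrite intr_eq0.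
rewrite integral_circle; last first.
  by apply: (integrable_cos (mu := circle)) mf; rewrite ltey_eq fin_num_measure.
have pi2_gt0 : 0 < 2 * pi :> R by rewrite mulr_gt0 ?pi_gt0.
have dF (x : R) : is_derive x 1 (fun x => m%:~R^-1 * sin (a + m%:~R * x))
    (cos (a + m%:~R * x)).
  apply: is_derive_eq.
  by rewrite add0r mul1r /GRing.scale /= mulr1 mulrCA mulVf ?mulr1.
have cf : continuous (fun x : R => cos (a + m%:~R * x)).
  move=> x; apply: continuous_comp; last exact: continuous_cos.
  apply: cvgD; first exact: cvg_cst.
  by apply: cvgM; [exact: cvg_cst|exact: cvg_id].
have cF : continuous (fun x : R => m%:~R^-1 * sin (a + m%:~R * x)).
  move=> x; apply/differentiable_continuous/derivable1_diffP.
  exact: ex_derive.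
(* The fundamental theorem of calculus is applied on the closed interval; adding the endpoint
   [2 * pi] does not change the integral. *)
rewrite integral_itv_bndo_bndc; last first.
  apply/measurable_EFinP/(measurable_funS measurableT) => //.
  exact: continuous_measurable_fun.
rewrite (continuous_FTC2 (F := fun x => m%:~R^-1 * sin (a + m%:~R * x)))//.
- by rewrite sinDpi2z mulr0 addr0 -EFinB subrr.
- exact: continuous_subspaceT.
- split => [x _||].
  + exact: ex_derive.
  + exact: cvg_at_right_filter (cF _).
  + exact: cvg_at_left_filter (cF _).
- by move=> x _; rewrite derive1E; exact: derive_val.
Qed.

(* The phase a absorbs the other coordinates in the induction, and a = - pi / 2
   turns cos into sin. *)
Lemma integral_torus_cos d (k : 'I_d -> int) (a : R) :
  (exists i, k i != 0) -> (\int[torus d]_x (cos (a + dot k x))%:E = 0)%E.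
Proof.
elim: d k a => [|d IHd] k a [i ki]; first by case: i ki.
have dotS x (y : pt d) : dot k (cons_pt (x, y)) =
    (k ord0)%:~R * x + dot (fun j => k (lift ord0 j)) y.
  rewrite /dot big_ord_recl; congr (_ + _).
  by apply: eq_bigr => j _; rewrite tnthS.
have mcos : measurable_fun setT (fun x : pt d.+1 => (cos (a + dot k x))%:E).
  by apply/measurable_EFinP; exact: measurable_cos_dot.
have fin_prod : ((circle \x torus d)%E setT < +oo)%E.
  by rewrite -setXTT product_measure1E// ltey_eq fin_numM// fin_num_measure.
have int_cos : (circle \x torus d)%E.-integrable setT
    ((fun x : pt d.+1 => (cos (a + dot k x))%:E) \o (@cons_pt R d)).
  apply: (@integrable_cos _ _ (circle \x torus d)%E
    (fun z => a + dot k (cons_pt z))).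
    exact: fin_prod.
  apply: measurable_funD; first exact: measurable_cst.
  exact: measurableT_comp (measurable_dot k) (@measurable_cons_pt R d).
(* By construction the measure in dimension [d.+1] is the pushforward of this product along
   [cons_pt]. *)
rewrite [LHS](_ : _ = \int[circle \x torus d]_z
    (cos (a + dot k (cons_pt z)))%:E)%E; last first.
  by rewrite /= (integral_pushforward (@measurable_cons_pt R d)).
(* Fubini, in the order that makes the inner integral vanish: by induction if the first frequency is
   zero, by [integral_circle_cos] otherwise. *)
have [k0|k0] := eqVneq (k ord0) 0.
  rewrite -integral12_prod_meas1//.
  apply: integral0_eq => x _; rewrite /fubini_F.
  under eq_integral do rewrite /= dotS addrA.
  apply: IHd.
  case: (unliftP ord0 i) ki => [j ->|->]; last by rewrite k0 eqxx.
  by exists j.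
rewrite -integral21_prod_meas1//.
apply: integral0_eq => y _; rewrite /fubini_G.
under eq_integral do rewrite /= dotS [_ + dot _ _]addrC addrA.
exact: integral_circle_cos.
Qed.

End Orthogonality.

(** * Linearity of Fourier coefficients, and coefficients of trigonometric polynomials *)

Section FourierCoefficients.
Context {R : realType} {d : nat}.
Local Notation pt := (d.-tuple R).
Local Notation freq := {ffun 'I_d -> int}.
Local Notation mu := (@torus_measure R d).
Implicit Types (v w p : pt -> R[i]) (k : freq).

(** [cintegral] is built from total real integrals; integrability of both components is what makes
    it linear. *)
Definition cintegrable v :=
  mu.-integrable setT (EFin \o (fun x => complex.Re (v x))) /\
  mu.-integrable setT (EFin \o (fun x => complex.Im (v x))).

(** The shape [c * v + w] serves both for differences, with [c = -1], and for building a
    trigonometric polynomial term by term. *)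
Lemma cintegrable_linear (c : R[i]) v w : cintegrable v -> cintegrable w ->
  cintegrable (fun x => c * v x + w x).
Proof.
move=> [rv iv] [rw iw]; split.
- rewrite [X in mu.-integrable _ X](_ : _ = fun x =>
    ((complex.Re c)%:E * (complex.Re (v x))%:E
     - (complex.Im c)%:E * (complex.Im (v x))%:E + (complex.Re (w x))%:E)%E).
    by apply: integrableD => //; apply: integrableB => //; exact: integrableZl.
  apply/funext => x /=.
  by case: c (v x) (w x) => [? ?] [? ?] [? ?].
- rewrite [X in mu.-integrable _ X](_ : _ = fun x =>
    ((complex.Re c)%:E * (complex.Im (v x))%:E
     + (complex.Im c)%:E * (complex.Re (v x))%:E + (complex.Im (w x))%:E)%E).
    by apply: integrableD => //; apply: integrableD => //; exact: integrableZl.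
  apply/funext => x /=.
  by case: c (v x) (w x) => [? ?] [? ?] [? ?].
Qed.

Lemma cintegral_linear (c : R[i]) v w : cintegrable v -> cintegrable w ->
  cintegral (fun x => c * v x + w x) = c * cintegral v + cintegral w.
Proof.
move=> [rv iv] [rw iw]; rewrite /cintegral.
case: c => a b; rewrite /GRing.mul /GRing.add /=.
have intZ (r : R) (f : pt -> R) : mu.-integrable setT (EFin \o f) ->
  mu.-integrable setT (EFin \o (fun x => r * f x)).
  exact: integrableZl.
have intD (f g : pt -> R) : mu.-integrable setT (EFin \o f) ->
  mu.-integrable setT (EFin \o g) ->
  mu.-integrable setT (EFin \o (fun x => f x + g x)).
  by move=> intf intg; exact: (integrableD _ intf intg).
have intB (f g : pt -> R) : mu.-integrable setT (EFin \o f) ->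
  mu.-integrable setT (EFin \o g) ->
  mu.-integrable setT (EFin \o (fun x => f x - g x)).
  by move=> intf intg; exact: (integrableB _ intf intg).
congr Complex.
- rewrite -!RintegralZl// -RintegralB//; [|exact: intZ..].
  rewrite -RintegralD//.
    by apply: eq_Rintegral => x _; case: (v x) (w x) => [? ?] [? ?].
  by apply: intB; exact: intZ.
- rewrite -!RintegralZl// -RintegralD//; [|exact: intZ..].
  rewrite -RintegralD//.
    by apply: eq_Rintegral => x _; case: (v x) (w x) => [? ?] [? ?].
  by apply: intD; exact: intZ.
Qed.

Lemma sin_cos_shift (t : R) : sin t = cos (- (pi / 2) + t).
Proof. by rewrite addrC cosBpihalf. Qed.

(** Each component of the product combines the components of [v] with bounded cosines of phase [0]
    or [- (pi / 2)]. *)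
Lemma cintegrable_mul_conj_phi v k :
  cintegrable v -> cintegrable (fun x => v x * conjc (phi k x)).
Proof.
move=> [rv iv].
have intM (f : pt -> R) (a : R) : mu.-integrable setT (EFin \o f) ->
  mu.-integrable setT (fun x => (f x)%:E * (cos (a + dot k x))%:E)%E.
  move=> intf; apply: integrableMl => //; first exact: measurable_cos_dot.
  exact: bounded_cos.
split.
- rewrite [X in mu.-integrable _ X](_ : _ = fun x =>
    ((complex.Re (v x))%:E * (cos (0 + dot k x))%:E
     + (complex.Im (v x))%:E * (cos (- (pi / 2) + dot k x))%:E)%E).
    by apply: integrableD => //; exact: intM.
  apply/funext => x /=; rewrite add0r -sin_cos_shift /phi -/(dot k x).
  by case: (v x) => a b /=; rewrite mulrN opprK.
- rewrite [X in mu.-integrable _ X](_ : _ = fun x =>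
    ((complex.Im (v x))%:E * (cos (0 + dot k x))%:E
     - (complex.Re (v x))%:E * (cos (- (pi / 2) + dot k x))%:E)%E).
    by apply: integrableB => //; exact: intM.
  apply/funext => x /=; rewrite add0r -sin_cos_shift /phi -/(dot k x).
  by case: (v x) => a b /=; rewrite mulrN addrC.
Qed.

Lemma fourier_linear (c : R[i]) v w k : cintegrable v -> cintegrable w ->
  fourier (fun x => c * v x + w x) k = c * fourier v k + fourier w k.
Proof.
move=> iv iw; rewrite /fourier /inner -cintegral_linear//;
  [|exact: cintegrable_mul_conj_phi..].
by congr cintegral; apply/funext => x; rewrite mulrDl mulrA.
Qed.

Lemma cintegrableB v w :
  cintegrable v -> cintegrable w -> cintegrable (fun x => v x - w x).
Proof.
move=> iv iw; rewrite (_ : (fun x => _) = (fun x => -1 * w x + v x)).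
  exact: cintegrable_linear.
by apply/funext => x; rewrite mulN1r addrC.
Qed.

Lemma fourierB v w k : cintegrable v -> cintegrable w ->
  fourier (fun x => v x - w x) k = fourier v k - fourier w k.
Proof.
move=> iv iw; rewrite (_ : (fun x => _) = (fun x => -1 * w x + v x)).
  by rewrite fourier_linear// mulN1r addrC.
by apply/funext => x; rewrite mulN1r addrC.
Qed.

Lemma cintegrable0 : cintegrable (fun=> 0).
Proof. by split; exact: integrable0. Qed.

(** The torus has finite measure, so [1 + |v|^2] is integrable, and it dominates both components
    because [|a| <= 1 + a^2 + b^2]. *)
Lemma cintegrable_in_L2 v : in_L2 v -> cintegrable v.
Proof.
move=> [_ mr mi fin].
have normE x : Normc.normc (v x) ^+ 2 =
    complex.Re (v x) ^+ 2 + complex.Im (v x) ^+ 2.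
  by case: (v x) => a b /=; rewrite sqr_sqrtr// addr_ge0// sqr_ge0.
have int2 : mu.-integrable setT (fun x => (1 + Normc.normc (v x) ^+ 2)%:E).
  under eq_fun do rewrite EFinD.
  apply: integrableD => //.
    exact: (finite_measure_integrable_cst mu 1).
  apply/integrableP; split.
    apply/measurable_EFinP; under eq_fun do rewrite normE.
    by apply: measurable_funD; exact: measurable_funX.
  by under eq_integral do rewrite gee0_abs ?lee_fin ?sqr_ge0//.
have sq1 (a b : R) : `|a| <= `|1 + (a ^+ 2 + b ^+ 2)|.
  rewrite [leRHS]ger0_norm; last by nra.
  by rewrite ler_norml; apply/andP; split; nra.
split; apply: le_integrable int2 => //; try exact/measurable_EFinP.
- by move=> x _; rewrite /= lee_fin normE.
- by move=> x _; rewrite /= lee_fin normE [_ ^+ 2 + _]addrC.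
Qed.

Lemma cintegrable_phi k : cintegrable (@phi R d k).
Proof.
have ic (a : R) : mu.-integrable setT (EFin \o (cos \o (fun x => a + dot k x))).
  apply: integrable_cos; first by rewrite ltey_eq fin_num_measure.
  by apply: measurable_funD; [exact: measurable_cst|exact: measurable_dot].
split.
- by apply: eq_integrable (ic 0) => // x _; rewrite /= add0r.
- apply: eq_integrable (ic (- (pi / 2))) => // x _.
  by rewrite /= -sin_cos_shift.
Qed.

(** The integrand is the exponential of the nonzero frequency [j - k]; phases [0] and [- (pi / 2)]
    give its real and imaginary parts. *)
Lemma fourier_phi (j k : freq) : j != k -> fourier (@phi R d j) k = 0.
Proof.
move=> jk; pose l : 'I_d -> int := fun i => j i - k i.
have dotB (x : pt) : dot l x = dot j x - dot k x.
  rewrite /dot -sumrB; apply: eq_bigr => i _.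
  by rewrite /l intrB mulrBl.
have [i li] : exists i, l i != 0.
  apply/existsP; apply: contraNT jk => /existsPn jk; apply/eqP/ffunP => i.
  by apply/eqP; rewrite -subr_eq0; apply/negPn/jk.
rewrite /fourier /inner /cintegral -[RHS]/(Complex 0 0); congr Complex.
- rewrite /Rintegral -[RHS]/(fine 0); congr fine.
  rewrite -[RHS](@integral_torus_cos R d l 0); last by exists i.
  apply: eq_integral => x _; rewrite add0r dotB cosB /phi /= -!/(dot _ x).
  by rewrite mulrN opprK.
- rewrite /Rintegral -[RHS]/(fine 0); congr fine.
  rewrite -[RHS](@integral_torus_cos R d l (- (pi / 2))); last by exists i.
  apply: eq_integral => x _.
  rewrite -sin_cos_shift dotB sinB /phi /= -!/(dot _ x).
  by rewrite mulrN addrC.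
Qed.

Lemma finite_Zn n : finite_set (@Zn d n).
Proof.
(* A coordinate [k i] is coded by [k i + n./2], a natural number at most [n]; the successor in
   ['I_n.+1] lets [inord] apply. *)
pose f (g : {ffun 'I_d -> 'I_n.+1}) : freq :=
  [ffun i => (g i : nat)%:Z - (n./2)%:Z].
apply: (@sub_finite_set _ _ (f @` setT)); last first.
  by apply: finite_image; exact: finite_finset.
move=> k kn; exists [ffun i => inord (absz (k i + (n./2)%:Z))] => //.
apply/ffunP => i; have /andP[ki1 ki2] := kn i.
have h2 : (n./2 + n./2 <= n)%N.
  by rewrite addnn -[leqRHS]odd_double_half leq_addl.
rewrite !ffunE; move: (n./2) h2 ki1 ki2 => h h2 ki1 ki2.
have kh : 0 <= k i + h%:Z by rewrite -lerBlDr sub0r.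
have kh2 : (absz (k i + h%:Z)%R < n.+1)%N.
  by rewrite -ltz_nat gez0_abs//; move: (k i) ki2 => m; lia.
by rewrite inordK// gez0_abs// addrK.
Qed.

(** Induction on the number of terms. The step keeps [Zn n k], which the vanishing of coefficients
    outside [Zn n] relies on. *)
Lemma in_Sn_ind n (P : (pt -> R[i]) -> Prop) :
  P (fun=> 0) ->
  (forall c k w, Zn n k -> P w -> P (fun x => c * phi k x + w x)) ->
  forall p, in_Sn n p -> P p.
Proof.
move=> P0 PS p [c pE].
pose zn := finmap.enum_fset (fset_set (@Zn d n)).
rewrite (_ : p = fun x => \sum_(k <- zn) c k * phi k x).
  (* Only the inclusion in [Zn n] is kept for the induction, since a tail of [zn] no longer
     enumerates [Zn n]. *)
  have : {subset zn <= [pred k : freq | k \in Zn n]}.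
    move=> k; rewrite !inE => kn.
    by have := in_fset_set (@finite_Zn n) k; rewrite kn => /esym/set_mem.
  elim: zn => [_|k s IH ks].
    by rewrite (_ : (fun=> _) = fun=> 0)//; apply/funext => x; rewrite big_nil.
  rewrite (_ : (fun=> _) =
    fun x => c k * phi k x + \sum_(j <- s) c j * phi j x); last first.
    by apply/funext => x; rewrite big_cons.
  apply: PS; first by have := ks k (mem_head _ _); rewrite !inE.
  by apply: IH => j js; apply: ks; rewrite in_cons js orbT.
by apply/funext => x; rewrite pE fsbig_finite//; exact: finite_Zn.
Qed.

Lemma cintegrable_in_Sn n p : in_Sn n p -> cintegrable p.
Proof.
move: p; apply: in_Sn_ind => [|c k w _ iw]; first exact: cintegrable0.
by apply: cintegrable_linear => //; exact: cintegrable_phi.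
Qed.

Lemma fourier0 k : fourier (fun=> 0 : R[i]) k = 0.
Proof.
rewrite (_ : (fun=> 0) = fun x : pt => 0 - 0).
  by rewrite fourierB ?subrr//; exact: cintegrable0.
by rewrite subrr.
Qed.

Lemma fourier_in_Sn n p k : in_Sn n p -> ~ Zn n k -> fourier p k = 0.
Proof.
(* Integrability is carried through the induction because [fourier_linear] asks for it on the
   partial sum [w]. *)
move=> pn kn; suff [] : cintegrable p /\ fourier p k = 0 by [].
move: p pn; apply: in_Sn_ind => [|c j w jn [iw wk]].
  by split; [exact: cintegrable0|exact: fourier0].
have ij := cintegrable_phi j; split; first exact: cintegrable_linear.
rewrite fourier_linear// wk addr0 fourier_phi ?mulr0//.
by apply: contra_notN kn => /eqP <-.
Qed.

(** Makes these exponentials admissible test functions in the orthogonality that defines [P_n]. *)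
Lemma phi_in_Sn n k : Zn n k -> in_Sn n (@phi R d k).
Proof.
move=> kn; exists (fun j => (j == k)%:R) => x.
rewrite (fsbigD1 k)//=; last exact: finite_Zn.
rewrite eqxx mul1r fsbig1 ?addr0// => j [_ /eqP/negPf ->].
by rewrite mul0r.
Qed.

End FourierCoefficients.

(** * Scaling of sums, square roots of extended reals, and the inequality for one frequency *)

Lemma esumZl (R : realType) (T : choiceType) (I : set T) (a : T -> \bar R)
    (c : R) : 0 <= c -> (forall i, (0 <= a i)%E) ->
  (\esum_(i in I) (c%:E * a i) = c%:E * \esum_(i in I) a i)%E.
Proof.
move=> c0 a0; rewrite /esum -ereal_supZl//; last first.
  (* The empty partial sum shows that the supremum is taken over a nonempty set. *)
  by apply/set0P; exists (\sum_(x \in set0) a x)%E; exists set0 => //; split.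
congr ereal_sup; rewrite image_comp; apply: eq_imagel => A [finA AI] /=.
by rewrite ge0_mule_fsumr.
Qed.

(** For finite values this is [(a + b)^2 <= 2 (a^2 + b^2)], that is [0 <= (a - b)^2]; otherwise the
    right side is infinite. *)
Lemma sqrteD_le (R : realType) (x y : \bar R) : (0 <= x)%E -> (0 <= y)%E ->
  (sqrte x + sqrte y <= sqrte (2%:E * (x + y)))%E.
Proof.
move: x y => [x| |] [y| |]//; rewrite ?lee_fin => x0 y0.
- have hx := sqr_sqrtr x0; have hy := sqr_sqrtr y0.
  rewrite -(@ler_pXn2r _ 2%N)// ?nnegrE ?addr_ge0 ?sqrtr_ge0//.
  rewrite sqr_sqrtr ?mulr_ge0 ?addr_ge0//.
  move: (Num.sqrt x) (Num.sqrt y) hx hy => a b <- <-.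
  by have := sqr_ge0 (a - b); nra.
- by rewrite addey// gt0_muley ?lte_fin// leey.
- by rewrite addye// gt0_muley ?lte_fin// leey.
- by rewrite addye// gt0_muley ?lte_fin// leey.
Qed.

(** Turns the squared estimate into one for a sum of norms: the factor 2 of [sqrteD_le] cancels the
    one half in [c / 2], leaving [Num.sqrt c]. *)
Lemma sqrte_add_mul_le (R : realType) (c : R) (x y z : \bar R) : 0 <= c ->
  (0 <= x)%E -> (0 <= y)%E -> (0 <= z)%E ->
  (x + (c / 2)%:E * y <= (c / 2)%:E * z)%E ->
  (sqrte x + (Num.sqrt (c / 2))%:E * sqrte y <= (Num.sqrt c)%:E * sqrte z)%E.
Proof.
move=> c0 x0 y0 z0 h.
have c20 : (0 <= (c / 2)%:E)%E by rewrite lee_fin divr_ge0.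
rewrite -![(Num.sqrt _)%:E]/(sqrte _%:E) -!sqrteM//.
apply: le_trans (sqrteD_le x0 (mule_ge0 c20 y0)) _.
have -> : (c%:E * z = 2%:E * ((c / 2)%:E * z))%E.
  by rewrite muleA -EFinM mulrCA divff ?mulr1.
by rewrite lee_sqrt ?mule_ge0// lee_pmul2l// lte_fin.
Qed.

Lemma damped_le (R : realType) (a c x y : R) : 0 <= a -> 0 <= c -> 0 <= x ->
  (a + c) * x = c * y -> a * x ^+ 2 + c / 2 * x ^+ 2 <= c / 2 * y ^+ 2.
Proof.
move=> a0; rewrite le_eqVlt => /orP[/eqP <-|c0] x0 h.
  (* The case [c = 0] arises at frequency zero when [beta] is nonzero; both sides then vanish. *)
  have ax0 : a * x = 0 by rewrite -[a]addr0 h mul0r.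
  by rewrite expr2 mulrA ax0 !mul0r addr0.
(* After multiplication by [2 c] the right side is [((a + c) x)^2], which exceeds the left side by
   [(a x)^2]. *)
rewrite -(ler_pM2l (mulr_gt0 (ltr0n _ 2) c0)).
have -> : 2 * c * (c / 2 * y ^+ 2) = (c * y) ^+ 2 by field.
rewrite -h.
have : 0 <= (a * x) ^+ 2 by exact: sqr_ge0.
nra.
Qed.

(** * Sobolev norms: stability, projection error, comparison of orders *)

Section SobolevNorms.
Context {R : realType} {d : nat}.
Local Notation pt := (d.-tuple R).
Local Notation freq := {ffun 'I_d -> int}.
Implicit Types (v w : pt -> R[i]) (k : freq) (r : R).
Local Notation fnorm := (@freq_norm R d).

Lemma freq_norm0 : fnorm 0 = 0.
Proof.
by rewrite /freq_norm big1 ?sqrtr0// => i _; rewrite ffunE expr0n.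
Qed.

Lemma normr_le_freq_norm k i : `|(k i)%:~R| <= fnorm k.
Proof.
rewrite -sqrtr_sqr ler_sqrt ?sumr_ge0// => [|j _]; last exact: sqr_ge0.
by rewrite (bigD1 i)//= lerDl sumr_ge0// => j _; exact: sqr_ge0.
Qed.

Lemma freq_norm_ge1 k : k != 0 -> 1 <= fnorm k.
Proof.
move=> k0; have [i ki] : exists i, k i != 0.
  apply/existsP; apply: contraNT k0 => /existsPn k0; apply/eqP/ffunP => i.
  by rewrite ffunE; apply/eqP/negPn/k0.
apply: le_trans (normr_le_freq_norm k i).
by rewrite -intr_norm ler1z -gtz0_ge1 normr_gt0.
Qed.

(** Some coordinate leaves the range from [-n/2] to [n/2 - 1], so its modulus is at least [n/2];
    evenness identifies [n./2] with [n/2]. *)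
Lemma freq_norm_notin_Zn n k : ~~ odd n -> ~ Zn n k -> n%:R / 2 <= fnorm k.
Proof.
move=> neven kn.
have [i ki] : exists i, ~ (- (n./2)%:Z <= k i <= (n./2)%:Z - 1).
  by apply/existsNP => kn'; exact: kn.
apply: le_trans (normr_le_freq_norm k i).
have -> : n%:R / 2 = ((n./2)%:Z)%:~R :> R.
  by rewrite -[X in X%:R](even_halfK neven) -muln2 natrM mulfK.
rewrite -intr_norm ler_int.
by move: (k i) (n./2) ki => m h; lia.
Qed.

Lemma sobolev_term_ge0 r v k :
  (0 <= (fnorm k `^ (2 * r) * Normc.normc (fourier v k) ^+ 2)%:E)%E.
Proof. by rewrite lee_fin mulr_ge0 ?powR_ge0 ?sqr_ge0. Qed.

Lemma sobolev_sqnorm_ge0 r v : (0 <= sobolev_sqnorm r v)%E.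
Proof. by apply: esum_ge0 => k _; exact: sobolev_term_ge0. Qed.

(** The value 0 imposed at [k = 0] is already given by the multiplier, since zero to a nonzero power
    is 0. *)
Lemma fractional_laplacianE r v k : r != 0 ->
  fractional_laplacian r v k = (fnorm k `^ (2 * r))%:C%C * fourier v k.
Proof.
move=> r0; rewrite /fractional_laplacian; case: eqVneq => // ->.
by rewrite freq_norm0 powR0 ?mul0r// mulf_neq0// pnatr_eq0.
Qed.

(** One multiplier covers all cases: zero to the power 0 is 1, giving the identity for [r = 0], and
    zero to any other power is 0. *)
Lemma inv_fractional_laplacianE r v k :
  inv_fractional_laplacian r v k = (fnorm k `^ (2 * - r))%:C%C * fourier v k.
Proof.
rewrite /inv_fractional_laplacian mulrN; case: eqVneq => [->|r0].
  by rewrite mulr0 oppr0 powRr0 mul1r.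
case: eqVneq => // ->.
by rewrite freq_norm0 powR0 ?mul0r// oppr_eq0 mulf_neq0// pnatr_eq0.
Qed.

Lemma normc_real (a : R) : Normc.normc a%:C%C = `|a|.
Proof. by rewrite /= expr0n addr0 sqrtr_sqr. Qed.

Lemma sobolev_stability (s beta alpha : R) v w : s != 0 -> 0 < alpha ->
  solves_equation s beta alpha v w ->
  (sobolev_sqnorm s v + (alpha / 2)%:E * sobolev_sqnorm (- beta) v
     <= (alpha / 2)%:E * sobolev_sqnorm (- beta) w)%E.
Proof.
move=> s0 alpha0 eqn; have a20 : 0 <= alpha / 2 by rewrite divr_ge0// ltW.
rewrite /sobolev_sqnorm -!esumZl//; try by move=> *; exact: sobolev_term_ge0.
rewrite -esumD; last 2 first.
- by move=> *; exact: sobolev_term_ge0.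
- by move=> *; rewrite mule_ge0//; exact: sobolev_term_ge0.
apply: le_esum => k _; rewrite -!EFinM -EFinD lee_fin.
have := eqn k; rewrite fractional_laplacianE// !inv_fractional_laplacianE.
set a := fnorm k `^ (2 * s); set b := fnorm k `^ (2 * - beta).
have a0 : 0 <= a := powR_ge0 _ _; have b0 : 0 <= b := powR_ge0 _ _.
have ab0 : 0 <= alpha * b by rewrite mulr_ge0// ltW.
(* Moduli on both sides yield the hypothesis of [damped_le], with [alpha * b] in the role of [c]. *)
rewrite !mulrA -mulrDl -!rmorphM -rmorphD => /(congr1 (@Normc.normc R)).
rewrite !Normc.normcM !normc_real !ger0_norm ?addr_ge0// => h.
have x0 : 0 <= Normc.normc (fourier v k).
  by case: (fourier v k) => ? ?; exact: sqrtr_ge0.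
have := damped_le a0 ab0 x0 h.
by rewrite ![alpha * b / 2]mulrAC !expr2 !mulrA.
Qed.

(** By linearity the error solves the same equation with datum [g - gn], so the stability bound
    applies to it. *)
Lemma solves_equationB (s beta alpha : R) (u un g gn : pt -> R[i]) :
  cintegrable u -> cintegrable un -> cintegrable g -> cintegrable gn ->
  solves_equation s beta alpha u g -> solves_equation s beta alpha un gn ->
  solves_equation s beta alpha (fun x => u x - un x) (fun x => g x - gn x).
Proof.
move=> iu iun ig ign eu eun k; have := congr2 (fun x y => x - y) (eu k) (eun k).
rewrite /fractional_laplacian /inv_fractional_laplacian !fourierB//.
case: ifP => _; case: ifP => _.
- by rewrite !add0r !mulrBr.
- by rewrite !mulr0 !addr0 subrr.
- by move=> h; rewrite !mulrBr -h; ring.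
- by move=> h; rewrite !mulrBr -h; ring.
Qed.

Lemma sobolev_norm_projection (mu beta : R) n (g gn : pt -> R[i]) :
  (0 < n)%N -> ~~ odd n ->
  - beta <= mu -> cintegrable g -> is_L2_projection n g gn ->
  (sobolev_norm (- beta) (fun x => (g x - gn x)%R)
     <= ((n%:R / 2) `^ (- (mu + beta)))%:E * sobolev_norm mu g)%E.
Proof.
move=> n0 neven bmu ig [gnS orth].
have mb0 : 0 <= mu + beta by lra.
have n20 : 0 < n%:R / 2 :> R by rewrite divr_gt0// ltr0n.
set q := _ `^ _; have q0 : 0 <= q := powR_ge0 _ _.
(* Moving [q] under the root reduces the claim to a comparison of the two series term by term. *)
have -> : q%:E = sqrte (q ^+ 2)%:E by rewrite /sqrte sqrtr_sqr ger0_norm.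
rewrite /sobolev_norm -sqrteM ?lee_fin ?sqr_ge0//.
rewrite lee_sqrt ?mule_ge0 ?lee_fin ?sqr_ge0 ?sobolev_sqnorm_ge0//.
rewrite /sobolev_sqnorm -esumZl ?sqr_ge0//; last first.
  by move=> *; exact: sobolev_term_ge0.
apply: le_esum => k _; rewrite -EFinM lee_fin.
have [kn|kn] := pselect (Zn n k).
  (* Inside [Zn n], orthogonality tested against [phi k] says exactly that this coefficient of
     [g - gn] is zero. *)
  rewrite /fourier [inner _ (phi k)]orth; last exact: phi_in_Sn.
  rewrite Normc.normc0 expr0n mulr0 mulr_ge0 ?sqr_ge0//.
  by have := sobolev_term_ge0 mu g k; rewrite lee_fin.
rewrite fourierB//; last exact: cintegrable_in_Sn gnS.
rewrite (fourier_in_Sn gnS kn) subr0 [leRHS]mulrA.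
apply: ler_wpM2r; first exact: sqr_ge0.
have nk := freq_norm_notin_Zn neven kn.
have fk0 : 0 < fnorm k := lt_le_trans n20 nk.
(* The weight splits as [|k|^(-2 (mu + beta))] times [|k|^(2 mu)]; the first factor is at most [q^2]
   because [n/2 <= |k|] and [0 <= mu + beta]. *)
have -> : 2 * - beta = 2 * - (mu + beta) + 2 * mu by ring.
rewrite powRD; last by rewrite (gt_eqF fk0) implybT.
apply: ler_wpM2r; first exact: powR_ge0.
rewrite mulrC powRrM -powR_mulrn ?powR_ge0//.
rewrite ge0_ler_powR ?nnegrE ?powR_ge0//.
rewrite /q !powRN lef_pV2 ?posrE ?powR_gt0//.
by rewrite ge0_ler_powR// nnegrE ltW.
Qed.

(** Nonzero frequencies have [|k| >= 1], so no weight of order [-beta] exceeds the weight 1 of order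
    zero; at [k = 0] it is 1 or 0. *)
Lemma sobolev_norm_negative_le (beta : R) v : 0 <= beta ->
  (sobolev_norm (- beta) v <= sobolev_norm 0 v)%E.
Proof.
move=> b0; rewrite /sobolev_norm lee_sqrt ?sobolev_sqnorm_ge0//.
apply: le_esum => k _; rewrite lee_fin; apply: ler_wpM2r; first exact: sqr_ge0.
rewrite mulr0 powRr0; have [->|b1] := eqVneq beta 0.
  by rewrite oppr0 mulr0 powRr0.
have [->|k0] := eqVneq k 0.
  by rewrite freq_norm0 powR0// mulf_neq0 ?oppr_eq0// pnatr_eq0.
rewrite mulrN powRN invf_le1 ?powR_gt0//; last first.
  exact: lt_le_trans ltr01 (freq_norm_ge1 k0).
rewrite -[leLHS](powRr0 (fnorm k)) ler_powR ?mulr_ge0//.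
exact: freq_norm_ge1.
Qed.

End SobolevNorms.

(** * From stability to the projection and interpolation estimates *)

Theorem theorem9 (R : realType) (d : nat) (s beta alpha : R) (n : nat)
    (g gn u un : d.-tuple R -> R[i])
    (hd : (1 <= d)%N)
    (hs : 0 < s < 1) (hbeta : 0 <= beta <= 1) (halpha : 0 < alpha)
    (hn : (0 < n)%N) (hneven : ~~ odd n)
    (hg : in_L2 g) (hgn : in_Sn n gn)
    (hmean : 0 < beta -> vanishing_mean g /\ vanishing_mean gn)
    (hu : in_H s u) (humean : 0 < beta -> vanishing_mean u)
    (hueq : solves_equation s beta alpha u g)
    (hun : in_Sn n un) (hunmean : 0 < beta -> vanishing_mean un)
    (huneq : solves_equation s beta alpha un gn) :
  let e := fun x => u x - un x in
  (sobolev_sqnorm s e + (alpha / 2)%:E * sobolev_sqnorm (- beta) e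
     <= (alpha / 2)%:E * sobolev_sqnorm (- beta) (fun x => (g x - gn x)%R))%E
  /\
  (forall mu : R, - beta <= mu -> in_H mu g -> is_L2_projection n g gn ->
    (sobolev_norm s e + (Num.sqrt (alpha / 2))%:E * sobolev_norm (- beta) e
       <= (Num.sqrt alpha * (n%:R / 2) `^ (- (mu + beta)))%:E
            * sobolev_norm mu g)%E)
  /\
  (forall nu c : R, d%:R / 2 < nu -> interpolation_constant d nu c ->
    in_H nu g -> is_interpolant n g gn ->
    (sobolev_norm s e + (Num.sqrt (alpha / 2))%:E * sobolev_norm (- beta) e
       <= (Num.sqrt alpha * c * (n%:R / 2) `^ (- nu))%:E
            * sobolev_norm nu g)%E).
Proof.
move=> e.
have ig := cintegrable_in_L2 hg; have iu := cintegrable_in_L2 hu.1.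
have ign := cintegrable_in_Sn hgn; have iun := cintegrable_in_Sn hun.
have s0 : s != 0 by case/andP: hs => s0 _; rewrite gt_eqF.
have stab := sobolev_stability s0 halpha
  (solves_equationB iu iun ig ign hueq huneq).
split=> //.
(* Both (i) and (ii) start here; only the bound on [g - gn] differs. *)
have norm_stab : (sobolev_norm s e +
    (Num.sqrt (alpha / 2))%:E * sobolev_norm (- beta) e <=
    (Num.sqrt alpha)%:E * sobolev_norm (- beta) (fun x => (g x - gn x)%R))%E.
  by apply: sqrte_add_mul_le stab; rewrite ?sobolev_sqnorm_ge0// ltW.
split=> [mu hmu _ hproj|nu c _ [c0 hc] hnu hint]; apply: le_trans norm_stab _.
  rewrite EFinM -muleA lee_wpmul2l ?lee_fin ?sqrtr_ge0//.
  exact: sobolev_norm_projection.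
rewrite -mulrA EFinM -muleA lee_wpmul2l ?lee_fin ?sqrtr_ge0//.
(* The interpolation estimate concerns the norm of order zero, which dominates the one of order
   [-beta]. *)
apply: le_trans (sobolev_norm_negative_le _ _) _; first by case/andP: hbeta.
exact: hc.
Qed.
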